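(* Let $M$ be a non-zero finitely generated torsion-free module over a Noetherian integral domain $R$. Then the following are equivalent: (a) there exists a proper strongly irreducible submodule $N$ of $M$ such that $N:_RM$ is not a prime ideal of $R$; (b) there exist a prime ideal $\mathfrak p$ of $R$ and a submodule $N$ of $M$ such that $\mathfrak pM\nsubseteq N$ and $M_{\mathfrak p}$ is an arithmetical $R_{\mathfrak p}$-module.
   Context: All rings are commutative with non-zero identity. A submodule $N$ of $M$ is strongly irreducible if for all submodules $K,L$ of $M$, $K\cap L\subseteq N$ implies $K\subseteq N$ or $L\subseteq N$. $N:_RM=\{r\in R: rM\subseteq N\}$. A module over a ring $A$ is arithmetical if for each maximal ideal $\mathfrak m$ of $A$ the submodules of its localization at $\mathfrak m$ (over $A_{\mathfrak m}$) are linearly ordered by inclusion. *)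

(* Defs.v *)
From HB Require Import structures.
From mathcomp Require Import all_boot all_order all_algebra.
From mathcomp Require Import ring boolp.

Set Implicit Arguments.
Unset Strict Implicit.
Unset Printing Implicit Defensive.

Import GRing.Theory.
Local Open Scope ring_scope.
Local Open Scope quotient_scope.

(* Submodules are the library's [submodClosed V] and prime ideals its
   [prime_idealr A].  Both are boolean predicates, but with the excluded middle
   of boolp every [V -> Prop] is one, so no decidability is being assumed.
   Ideals that may be the whole ring are submodules of A^o, since [idealr A]
   only contains proper ideals. *)

Section Modules.
Variables (A : comNzRingType) (V : lmodType A).
Implicit Types (N : submodClosed V) (I : {pred A}).

Definition fin_gen (S : {pred V}) : Prop :=
  exists n (v : 'I_n -> V),
    forall x, x \in S <-> exists c : 'I_n -> A, x = \sum_i c i *: v i.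

Definition torsion_free : Prop :=
  forall (r : A) (x : V), r *: x = 0 -> r = 0 \/ x = 0.

Definition proper_submod N : Prop := exists x : V, x \notin N.

Definition strongly_irreducible N : Prop :=
  forall K L : submodClosed V,
    {subset [predI K & L] <= N} -> {subset K <= N} \/ {subset L <= N}.

(* the colon ideal N :_A V *)
Definition colon N : {pred A} := fun r => `[< forall x : V, r *: x \in N >].

(* the submodule IV: finite sums of products *)
Definition ideal_mul I : {pred V} := fun x =>
  `[< exists n (r : 'I_n -> A) (v : 'I_n -> V),
        (forall i, r i \in I) /\ x = \sum_i r i *: v i >].

Definition submod_chain : Prop :=
  forall K L : submodClosed V, {subset K <= L} \/ {subset L <= K}.

End Modules.
Arguments ideal_mul {A} V I.

Section Ideals.
Variable A : comNzRingType.
Implicit Types I J m : {pred A}.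

Definition noetherian : Prop := forall I : submodClosed A^o, fin_gen I.

Definition prime_ideal I : Prop := idealr_closed I /\ prime_idealr_closed I.

Definition maximal_ideal m : Prop :=
  idealr_closed m /\
  forall J, idealr_closed J -> {subset m <= J} -> {subset J <= m}.

Lemma maximal_ideal_prime m : maximal_ideal m -> prime_idealr_closed m.
Proof.
move=> [[m0 m1 mD] mmax] u v uvm.
have mM a x : x \in m -> a * x \in m.
  by move=> xm; rewrite -[a * x]addr0; apply: mD.
have mA x y : x \in m -> y \in m -> x + y \in m.
  by move=> xm ym; rewrite -[x]mul1r; apply: mD.
apply: contrapT => /negP; rewrite negb_or => /andP[um vm].
pose J : {pred A} := fun x => `[< exists2 y, y \in m & exists b, x = y + b * u >].
have JP x : reflect (exists2 y, y \in m & exists b, x = y + b * u) (x \in J).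
  exact: asboolP.
have Ju : u \in J.
  by apply/JP; exists 0 => //; exists 1; rewrite add0r mul1r.
have [J1|J1] := boolP (1 \in J).
  have /JP[y ym [b yb]] := J1.
  move: vm; rewrite -[v]mul1r yb mulrDl [y * v]mulrC -mulrA.
  by rewrite mA // mM.
move: um; rewrite (mmax J) //; last first.
  by move=> x xm; apply/JP; exists x => //; exists 0; rewrite mul0r addr0.
split => //; first by apply/JP; exists 0 => //; exists 0; rewrite mul0r addr0.
move=> a x y /JP[x' x'm [b ->]] /JP[y' y'm [c ->]].
apply/JP; exists (a * x' + y'); first by rewrite mA // mM.
by exists (a * b + c); rewrite mulrDr mulrDl mulrA addrACA.
Qed.

Definition maximal_prime m (hm : maximal_ideal m) : prime_idealr A :=
  HB.pack_for (prime_idealr A) (m : A -> bool)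
    (isIdealr.Build A m hm.1)
    (isPrimeIdealrClosed.Build A m (maximal_ideal_prime hm)).

End Ideals.

Section Localization.
Variables (A : comNzRingType) (P : prime_idealr A).

Definition denom : Type := {s : A | s \notin P}.
HB.instance Definition _ := Choice.copy denom {s : A | s \notin P}.

Implicit Types s t u : denom.

Lemma denom1_subproof : 1 \notin P.
Proof. by rewrite idealr1. Qed.
Definition denom1 : denom := Sub 1 denom1_subproof.

Lemma denomM_subproof s t : sval s * sval t \notin P.
Proof. by rewrite prime_idealrM negb_or (svalP s) (svalP t). Qed.
Definition denomM s t : denom := Sub (sval s * sval t) (denomM_subproof s t).

Lemma denom_inj s t : sval s = sval t -> s = t.
Proof. exact: val_inj. Qed.

Section Module.
Variable M : lmodType A.

(* x / s = y / t iff u t x = u s y for some denominator u *)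
Definition loc_rel (a b : M * denom) : bool :=
  `[< exists u, (sval u * sval b.2) *: a.1 = (sval u * sval a.2) *: b.1 >].

Lemma loc_rel_refl : reflexive loc_rel.
Proof. by move=> a; apply/asboolP; exists denom1. Qed.

Lemma loc_rel_sym : symmetric loc_rel.
Proof. by move=> a b; apply/asboolP/asboolP => -[u e]; exists u. Qed.

Lemma loc_rel_trans : transitive loc_rel.
Proof.
move=> [y t] [x s] [z w] /asboolP[u /= eu] /asboolP[v /= ev].
apply/asboolP; exists (denomM (denomM u v) t) => /=.
have -> : sval u * sval v * sval t * sval w =
          (sval v * sval w) * (sval u * sval t) by ring.
rewrite -scalerA eu scalerA.
have -> : sval v * sval w * (sval u * sval s) =
          (sval u * sval s) * (sval v * sval w) by ring.
by rewrite -scalerA ev scalerA; congr (_ *: _); ring.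
Qed.

Canonical loc_equiv := EquivRel loc_rel loc_rel_refl loc_rel_sym loc_rel_trans.

Definition locmod : Type := {eq_quot loc_rel}.
HB.instance Definition _ : EqQuotient _ loc_rel locmod := EqQuotient.on locmod.
HB.instance Definition _ := Choice.on locmod.

Definition locfrac (x : M) s : locmod := \pi_locmod (x, s).

Lemma locfracP x y s t :
  locfrac x s = locfrac y t <->
  exists u, (sval u * sval t) *: x = (sval u * sval s) *: y.
Proof.
split => [/eqmodP/asboolP //|e].
exact/eqmodP/asboolP.
Qed.

Lemma locfrac_eq x y s t :
  sval t *: x = sval s *: y -> locfrac x s = locfrac y t.
Proof. by move=> e; apply/locfracP; exists denom1; rewrite /= !mul1r. Qed.

Lemma locfrac_repr (a : locmod) : locfrac (repr a).1 (repr a).2 = a.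
Proof. by rewrite /locfrac -surjective_pairing reprK. Qed.

Lemma locfracW (Q : locmod -> Prop) :
  (forall x s, Q (locfrac x s)) -> forall a, Q a.
Proof. by move=> h a; rewrite -(locfrac_repr a). Qed.

Definition locadd (a b : locmod) : locmod :=
  let: (x, s) := repr a in let: (y, t) := repr b in
  locfrac (sval t *: x + sval s *: y) (denomM s t).

Definition locopp (a : locmod) : locmod :=
  let: (x, s) := repr a in locfrac (- x) s.

Variant repr_spec x s : M * denom -> Prop :=
  ReprSpec y t u of (sval u * sval s) *: y = (sval u * sval t) *: x :
    repr_spec x s (y, t).

Lemma reprP x s : repr_spec x s (repr (locfrac x s)).
Proof.
have := locfrac_repr (locfrac x s); case: (repr _) => y t /= /locfracP[u e].
exact: ReprSpec e.
Qed.

Lemma locaddE x y s t :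
  locadd (locfrac x s) (locfrac y t) =
  locfrac (sval t *: x + sval s *: y) (denomM s t).
Proof.
rewrite /locadd; case: reprP => x' s' u eu; case: reprP => y' t' v ev.
apply/locfracP; exists (denomM u v) => /=.
rewrite !scalerDr !scalerA; congr (_ + _).
  transitivity ((sval v * sval t * sval t') *: ((sval u * sval s) *: x')).
    by rewrite scalerA; congr (_ *: _); ring.
  by rewrite eu scalerA; congr (_ *: _); ring.
transitivity ((sval u * sval s * sval s') *: ((sval v * sval t) *: y')).
  by rewrite scalerA; congr (_ *: _); ring.
by rewrite ev scalerA; congr (_ *: _); ring.
Qed.

Lemma locoppE x s : locopp (locfrac x s) = locfrac (- x) s.
Proof.
rewrite /locopp; case: reprP => x' s' u eu.
by apply/locfracP; exists u; rewrite !scalerN eu.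
Qed.

Lemma locaddA : associative locadd.
Proof.
elim/locfracW=> x s; elim/locfracW=> y t; elim/locfracW=> z w.
rewrite !locaddE; apply: locfrac_eq.
rewrite /= !scalerDr !scalerA addrA.
by congr (_ *: _ + _ *: _ + _ *: _); ring.
Qed.

Lemma locaddC : commutative locadd.
Proof.
elim/locfracW=> x s; elim/locfracW=> y t; rewrite !locaddE addrC.
by congr locfrac; apply: denom_inj; rewrite /= mulrC.
Qed.

Lemma locadd0 : left_id (locfrac 0 denom1) locadd.
Proof.
elim/locfracW=> x s; rewrite locaddE scaler0 add0r scale1r.
by congr locfrac; apply: denom_inj; rewrite /= mul1r.
Qed.

Lemma locaddN : left_inverse (locfrac 0 denom1) locopp locadd.
Proof.
elim/locfracW=> x s; rewrite locoppE locaddE scalerN addNr.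
by apply: locfrac_eq; rewrite !scaler0.
Qed.

HB.instance Definition _ :=
  GRing.isZmodule.Build locmod locaddA locaddC locadd0 locaddN.

Lemma locfracD x y s t :
  locfrac x s + locfrac y t = locfrac (sval t *: x + sval s *: y) (denomM s t).
Proof. exact: locaddE. Qed.

Lemma locfracN x s : - locfrac x s = locfrac (- x) s.
Proof. exact: locoppE. Qed.

End Module.

(* (a / s) (x / t) = (a x) / (s t); for M = A^o this is the product of A_P *)
Definition locscale (M : lmodType A) (a : locmod A^o) (b : locmod M) :
    locmod M :=
  let: (r, s) := repr a in let: (x, t) := repr b in
  locfrac (r *: x) (denomM s t).

Lemma locscaleE (M : lmodType A) (r : A) (x : M) s t :
  locscale (locfrac (r : A^o) s) (locfrac x t) = locfrac (r *: x) (denomM s t).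
Proof.
rewrite /locscale.
case: (@reprP A^o) => r' s' u eu; case: (@reprP M) => x' t' v ev.
have {}eu : (sval u * sval s) * r' = (sval u * sval s') * r by exact: eu.
apply/locfracP; exists (denomM u v) => /=; rewrite !scalerA.
transitivity ((sval u * sval s * r') *: ((sval v * sval t) *: x')).
  by rewrite scalerA; congr (_ *: _); ring.
by rewrite eu ev scalerA; congr (_ *: _); ring.
Qed.

Section Scale.
Variable M : lmodType A.

Lemma locscaleA (a b : locmod A^o) (c : locmod M) :
  locscale a (locscale b c) = locscale (locscale a b) c.
Proof.
elim/locfracW: a => r s; elim/locfracW: b => r' s'; elim/locfracW: c => x t.
rewrite !locscaleE scalerA [r *: (r' : A^o)]/(r * r').
by congr locfrac; apply: denom_inj; rewrite /= mulrA.
Qed.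

Lemma locscale1 : left_id (locfrac (1 : A^o) denom1) (@locscale M).
Proof.
elim/locfracW=> x t; rewrite locscaleE scale1r.
by congr locfrac; apply: denom_inj; rewrite /= mul1r.
Qed.

Lemma locscaleDr : right_distributive (@locscale M) +%R.
Proof.
elim/locfracW=> r s; elim/locfracW=> x t; elim/locfracW=> y w.
rewrite !(locscaleE, locfracD); apply: locfrac_eq.
rewrite /= !(scalerDr, scalerA).
by congr (_ *: _ + _ *: _); ring.
Qed.

Lemma locscaleDl (c : locmod M) : {morph (@locscale M)^~ c : a b / a + b}.
Proof.
elim/locfracW=> r s; elim/locfracW=> r' s'; elim/locfracW: c => x t.
rewrite !(locscaleE, locfracD); apply: locfrac_eq.
rewrite /= scalerDr !scalerA -scalerDl; congr (_ *: x).
by rewrite /GRing.scale /=; ring.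
Qed.

End Scale.

(* the local ring A_P *)
Definition locring : Type := locmod A^o.
HB.instance Definition _ := GRing.Zmodule.on locring.

Lemma locmulC : commutative (@locscale A^o : locring -> locring -> locring).
Proof.
elim/locfracW=> r s; elim/locfracW=> r' s'; rewrite !locscaleE.
congr locfrac; first exact: mulrC.
by apply: denom_inj; rewrite /= mulrC.
Qed.

Lemma locmulDl :
  left_distributive (@locscale A^o : locring -> locring -> locring) +%R.
Proof. by move=> a b c; apply: locscaleDl. Qed.

Lemma locring1_neq0 : locfrac (1 : A^o) denom1 != 0 :> locring.
Proof.
apply/eqP => /locfracP[u /=].
rewrite scaler0 /GRing.scale /= !mulr1 => u0.
by have := svalP u; rewrite u0 idealr0.
Qed.

HB.instance Definition _ := GRing.Zmodule_isComNzRing.Build locring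
  (@locscaleA A^o) locmulC (@locscale1 A^o) locmulDl locring1_neq0.

HB.instance Definition _ (M : lmodType A) :=
  GRing.Zmodule_isLmodule.Build locring (locmod M)
    (@locscaleA M) (@locscale1 M) (@locscaleDr M) (@locscaleDl M).

Lemma locfracM (r r' : A) s s' :
  (locfrac (r : A^o) s : locring) * locfrac (r' : A^o) s' =
  locfrac (r * r' : A^o) (denomM s s').
Proof. exact: locscaleE. Qed.

Lemma locfracZ (M : lmodType A) (r : A) (x : M) s t :
  (locfrac (r : A^o) s : locring) *: locfrac x t =
  locfrac (r *: x) (denomM s t).
Proof. exact: locscaleE. Qed.

End Localization.

Definition arithmetical (A : comNzRingType) (M : lmodType A) : Prop :=
  forall (m : {pred A}) (hm : maximal_ideal m),
    submod_chain (locmod (maximal_prime hm) M).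

(* Main.v *)
(* M_P is arithmetical iff any two elements of M are multiples of one another
   up to denominators outside P, so one can argue in M itself. If this holds
   and P <> 0, then locally at P the ideal P is generated by some p and M by
   some x, and the y with s y in R p^2 x for some s outside P form a strongly
   irreducible submodule, whose colon ideal contains p^2 but not p.

   Conversely, let N be strongly irreducible and P = (N : x) a prime annihilator
   of some x outside N. Locally at P, the line R x contains N and is contained
   in every line that is not inside N. If the colon ideal of N is not prime,
   then P M is not inside N, so some y outside (R x)_P has P y inside (R x)_P;
   as x = c y up to denominators, P is generated by c locally. Powers of c carry
   every element into R x, so locally each nonzero z satisfies c^k z = c^i x up
   to units, and exponents of c compare any two elements. *)

From HB Require Import structures.
Require Import Defs.
From mathcomp Require Import all_boot all_order all_algebra.
From mathcomp Require Import ring boolp.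

Set Implicit Arguments.
Unset Strict Implicit.
Unset Printing Implicit Defensive.

Import GRing.Theory.
Local Open Scope ring_scope.

(** * Submodules given by propositional predicates, and intersections of lines *)

Definition is_submod (A : comNzRingType) (V : lmodType A) (p : V -> Prop) :=
  p 0 /\ forall a x y, p x -> p y -> p (a *: x + y).
Arguments is_submod {A} V p.

Section Submodules.
Variables (A : comNzRingType) (V : lmodType A).
Implicit Types p : V -> Prop.

Lemma ex_submodClosed p :
  is_submod V p -> exists K : submodClosed V, forall x, x \in K <-> p x.
Proof.
move=> [p0 pD]; pose S : {pred V} := fun x => `[< p x >].
have Sc : GRing.submod_closed S.
  split; first exact/asboolP.
  by move=> a x y /asboolP px /asboolP py; apply/asboolP/pD.
pose K : submodClosed V := HB.pack_for (submodClosed V) (S : V -> bool)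
  (GRing.isSubmodClosed.Build A V S Sc).
by exists K => x; split=> [/asboolP|px] //; apply/asboolP.
Qed.

Lemma submodClosed_is_submod (K : submodClosed V) :
  is_submod V (fun x => x \in K).
Proof. by split=> [|a x y xK yK]; rewrite ?rpred0 // rpredD // rpredZ. Qed.

Lemma scaler_swap (a b : A) (x : V) : a *: (b *: x) = b *: (a *: x).
Proof. by rewrite !scalerA mulrC. Qed.

Lemma is_submodZ p a x : is_submod V p -> p x -> p (a *: x).
Proof. by move=> [p0 pD] px; rewrite -[_ *: _]addr0; apply: pD. Qed.

Lemma is_submodD p x y : is_submod V p -> p x -> p y -> p (x + y).
Proof. by move=> [p0 pD] px py; rewrite -[x]scale1r; apply: pD. Qed.

Lemma is_submod_sum p n (c : 'I_n -> A) (v : 'I_n -> V) :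
  is_submod V p -> (forall i, p (v i)) -> p (\sum_i c i *: v i).
Proof.
move=> sp pv; apply: (big_ind p) => [|x y|i _]; first by case: sp.
  exact: is_submodD.
exact: is_submodZ.
Qed.

Lemma is_submod_cyclic y : is_submod V (fun x => exists c, x = c *: y).
Proof.
split=> [|a _ _ [c ->] [d ->]]; first by exists 0; rewrite scale0r.
by exists (a * c + d); rewrite scalerDl scalerA.
Qed.

Lemma is_submod_transporter p x :
  is_submod V p -> is_submod A^o (fun r => p (r *: x)).
Proof.
move=> [p0 pD]; split=> [|a r s pr ps]; first by rewrite scale0r.
by rewrite scalerDl -scalerA; apply: pD.
Qed.

(** Neither of the lines through [x] and [y] lies in [N], so their intersection does not either. *)
Lemma strongly_irreducible_cyclic (N : submodClosed V) x y :
    strongly_irreducible N -> x \notin N -> y \notin N ->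
  exists a b, a *: x = b *: y /\ a *: x \notin N.
Proof.
move=> hN xN yN; apply: contrapT => hab.
have [K HK] := ex_submodClosed (is_submod_cyclic x).
have [L HL] := ex_submodClosed (is_submod_cyclic y).
have [z /andP[/HK[a ->] /HL[b ab]]|KN|LN] := hN K L.
- by apply: contrapT => /negP abN; apply: hab; exists a, b.
- by move/negP: xN; apply; apply/KN/HK; exists 1; rewrite scale1r.
- by move/negP: yN; apply; apply/LN/HL; exists 1; rewrite scale1r.
Qed.

End Submodules.

(** * The maximal condition and associated primes over a Noetherian ring *)

Section Noetherian.
Variables (A : comNzRingType) (hA : noetherian A).

(** Otherwise choice yields a strictly increasing sequence of ideals, whose union is finitely
    generated and hence reached at a finite stage. *)
Lemma noetherian_max (T : Type) (D : T -> Prop) (I : T -> A -> Prop) t0 :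
    (forall t, is_submod A^o (I t)) -> D t0 ->
  exists2 t, D t &
    forall u, D u -> (forall r, I t r -> I u r) -> forall r, I u r -> I t r.
Proof.
move=> sI Dt0; apply: contrapT => nomax.
have step (t : {t | D t}) : exists u : {t | D t},
    (forall r, I (sval t) r -> I (sval u) r) /\
    exists r, I (sval u) r /\ ~ I (sval t) r.
  case: t => t Dt /=; apply: contrapT => not_u; apply: nomax; exists t => //.
  move=> u Du tu r ur; apply: contrapT => tr; apply: not_u.
  by exists (exist _ u Du); split => //; exists r.
have [f /all_and2[fI fN]] := choice step.
pose t n := sval (iter n f (exist _ t0 Dt0)).
have tS n m r : (n <= m)%N -> I (t n) r -> I (t m) r.
  move=> /subnK <-; elim: (m - n)%N => // k IH tn.
  by apply: fI; apply: IH.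
have sU : is_submod A^o (fun r => exists n, I (t n) r).
  split=> [|a r s [n nr] [m ms]]; first by exists 0%N; case: (sI (t 0%N)).
  exists (maxn n m); case: (sI (t (maxn n m))) => _; apply.
    by apply: tS nr; apply: leq_maxl.
  by apply: tS ms; apply: leq_maxr.
have [U HU] := ex_submodClosed sU.
have [n [v Uv]] := hA U.
have Iv i : exists k, I (t k) (v i).
  apply/HU/Uv; exists (fun j => (j == i)%:R).
  rewrite (bigD1 i) //= eqxx scale1r big1 ?addr0 // => j /negPf ->.
  by rewrite scale0r.
have [k kv] := choice Iv.
(* All generators of the union lie in stage [m], yet stage [m.+1] is strictly larger. *)
pose m := (\max_i k i)%N.
have [r [Ir]] := fN (iter m f (exist _ t0 Dt0)); apply.
have /Uv[c ->] : r \in U by apply/HU; exists m.+1.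
apply: is_submod_sum => // i.
by apply: tS (kv i); apply: leq_bigmax.
Qed.

(** A maximal one among the annihilators, modulo [p], of the multiples of [x] outside [p] is
    prime. *)
Lemma ex_associated_prime (V : lmodType A) (p : V -> Prop) x :
    is_submod V p -> ~ p x ->
  exists r (P : prime_idealr A), ~ p (r *: x) /\
    forall a, a \in P <-> p (a *: (r *: x)).
Proof.
move=> sp px; have [p0 pD] := sp.
have [||r npr rmax] := noetherian_max
  (D := fun r => ~ p (r *: x)) (I := fun r a => p (a *: (r *: x))) (t0 := 1).
- by move=> r; apply: is_submod_transporter.
- by rewrite scale1r.
pose Q : {pred A} := fun a => `[< p (a *: (r *: x)) >].
have Qi : idealr_closed Q.
  split=> [||a u v /asboolP Qu /asboolP Qv].
  - by apply/asboolP; rewrite scale0r.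
  - by apply/asboolP; rewrite scale1r.
  by apply/asboolP; rewrite scalerDl -scalerA; apply: pD.
have Qp : prime_idealr_closed Q.
  move=> a b /asboolP pab; apply: contrapT => /negP.
  rewrite negb_or => /andP[/asboolP pa /asboolP pb]; apply: pa.
  (* If [b] is outside [Q], then [b * r] still competes, and its annihilator contains both [Q] and
     [a]. *)
  apply: (rmax (b * r)); first by rewrite -scalerA.
    move=> c pc; rewrite -scalerA (scaler_swap c).
    exact: is_submodZ sp pc.
  by rewrite -scalerA (scalerA a).
pose P : prime_idealr A := HB.pack_for (prime_idealr A) (Q : A -> bool)
  (isIdealr.Build A Q Qi) (isPrimeIdealrClosed.Build A Q Qp).
by exists r, P; split=> // a; split=> [/asboolP|pa] //; apply/asboolP.
Qed.

End Noetherian.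

(** * The arithmetical condition at a prime, expressed without fractions *)

Definition prime_loc_chain (A : comNzRingType) (P : prime_idealr A)
    (V : lmodType A) : Prop :=
  forall x y : V, exists2 s, s \notin P &
    exists r, s *: x = r *: y \/ s *: y = r *: x.
Arguments prime_loc_chain {A} P V.

Lemma locmod_chain (A : comNzRingType) (P : prime_idealr A) (V : lmodType A) :
    (forall x y : V, exists r, x = r *: y \/ y = r *: x) ->
  submod_chain (locmod P V).
Proof.
move=> hV K L; apply: contrapT => /not_orP[KL LK].
have [a [aK aL]] : exists a, a \in K /\ a \notin L.
  apply: contrapT => ha; apply: KL => a aK.
  by apply: contrapT => /negP aL; apply: ha; exists a.
have [b [bL bK]] : exists b, b \in L /\ b \notin K.
  apply: contrapT => hb; apply: LK => b bL.
  by apply: contrapT => /negP bK; apply: hb; exists b.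
elim/locfracW: a => x s in aK aL; elim/locfracW: b => y t in bL bK.
have locZ (z w : V) (u v : denom P) r : z = r *: w ->
    locfrac z u = (locfrac (r * sval v : A^o) u : locring P) *: locfrac w v.
  move=> ->; rewrite locfracZ; apply: locfrac_eq; rewrite /= !scalerA.
  by congr (_ *: _); ring.
have [r [/locZ xy|/locZ yx]] := hV x y.
  by move/negP: aL; apply; rewrite (xy s t) rpredZ.
by move/negP: bK; apply; rewrite (yx t s) rpredZ.
Qed.

Section LocalizedChain.
Variables (A : comNzRingType) (P : prime_idealr A).

Lemma notin_primeM s t : s \notin P -> t \notin P -> s * t \notin P.
Proof. by move=> sP tP; rewrite prime_idealrM negb_or sP. Qed.

(** This gives one maximal ideal of the local ring at which [arithmetical] can be tested; a fraction
    with numerator outside [P] is a unit. *)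
Lemma maximal_ideal_locring :
  exists2 m : {pred locring P}, maximal_ideal m &
    forall (r : A) s, (locfrac (r : A^o) s : locring P) \in m <-> r \in P.
Proof.
pose m : {pred locring P} := fun a => `[< exists (r : A) (s : denom P),
  r \in P /\ a = locfrac (r : A^o) s >].
have mP (r : A) s : (locfrac (r : A^o) s : locring P) \in m <-> r \in P.
  split=> [/asboolP[r' [s' [r'P /locfracP[u]]]]|rP]; last first.
    by apply/asboolP; exists r, s.
  rewrite /GRing.scale /= => e.
  have : sval u * sval s' * r \in P by rewrite e idealMr.
  by rewrite !prime_idealrM (negPf (svalP u)) (negPf (svalP s')).
exists m => //; split.
  split; first by apply/mP; rewrite idealr0.
    by apply/negP => /mP; rewrite idealr1.
  elim/locfracW => c w; elim/locfracW => r s; elim/locfracW => r' s'.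
  move=> /mP rP /mP r'P; rewrite locfracM locfracD; apply/mP.
  by rewrite /GRing.scale /=; apply: rpredD; rewrite ?idealMr.
move=> J [J0 J1 JD] mJ; elim/locfracW => r s rJ; apply/mP.
apply: contrapT => /negP rP; move/negP: J1; apply.
rewrite -[1]addr0.
have -> : 1 = (locfrac (sval s : A^o) (exist _ r rP) : locring P) *
              locfrac (r : A^o) s.
  rewrite locfracM; apply: locfrac_eq.
  by rewrite /GRing.scale /= mulr1 mul1r mulrC.
exact: JD.
Qed.

(** The module is localized twice, at [P] and then at a maximal ideal [m]. From right to left,
    elements are already comparable after the first localization, so any [m] will do; from left to
    right, two layers of denominators are cleared. *)
Lemma arithmetical_locmodP (V : lmodType A) :
  arithmetical (locmod P V) <-> prime_loc_chain P V.
Proof.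
split=> [ar x y|ch m hm]; last first.
  apply: locmod_chain => a b.
  elim/locfracW: a => x s; elim/locfracW: b => y t.
  have [u uP [r [e|e]]] := ch x y.
    exists (locfrac (r * sval t : A^o) (denomM (exist _ u uP) s)); left.
    rewrite locfracZ; apply: locfrac_eq => /=.
    transitivity ((sval s * sval t) *: (u *: x)).
      by rewrite scalerA; congr (_ *: _); ring.
    by rewrite e !scalerA; congr (_ *: _); ring.
  exists (locfrac (r * sval s : A^o) (denomM (exist _ u uP) t)); right.
  rewrite locfracZ; apply: locfrac_eq => /=.
  transitivity ((sval s * sval t) *: (u *: y)).
    by rewrite scalerA; congr (_ *: _); ring.
  by rewrite e !scalerA; congr (_ *: _); ring.
have [m hm mP] := maximal_ideal_locring.
pose io (z : V) : locmod (maximal_prime hm) (locmod P V) :=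
  locfrac (locfrac z (denom1 P)) (denom1 _).
have key (z w : V) :
    (exists a : locring (maximal_prime hm), io z = a *: io w) ->
    exists2 s, s \notin P & exists r, s *: z = r *: w.
  case; elim/locfracW => al be; rewrite locfracZ => /locfracP[ga /=].
  case: be => be beP; case: ga => ga gaP /=.
  elim/locfracW: al => a a'.
  elim/locfracW: be beP => b b' /negP beP.
  elim/locfracW: ga gaP => g g' /negP gaP.
  (* The outer denominators lie outside [m], so their numerators lie outside [P]. *)
  have bP : b \notin P by apply/negP => /(mP b b').
  have gP : g \notin P by apply/negP => /(mP g g').
  rewrite mulr1 mulr1 !locfracM !locfracZ => /locfracP[u /=] e.
  exists (sval u * (sval g' * sval a' * 1) * (g * b)).
    by rewrite !notin_primeM // ?idealr1 ?(svalP u) ?(svalP g') ?(svalP a').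
  exists (sval u * (sval g' * sval b' * 1) * (g * a)).
  by move: e; rewrite !scalerA !mulr1 !mulrA.
have [K HK] := ex_submodClosed (is_submod_cyclic (io x)).
have [L HL] := ex_submodClosed (is_submod_cyclic (io y)).
have [KL|LK] := ar m hm K L.
  have /HL/key[s sP [r e]] : io x \in L.
    by apply/KL/HK; exists 1; rewrite scale1r.
  by exists s => //; exists r; left.
have /HK/key[s sP [r e]] : io y \in K.
  by apply/LK/HL; exists 1; rewrite scale1r.
by exists s => //; exists r; right.
Qed.

End LocalizedChain.

(** * Torsion-free modules over a domain, and locally principal primes *)

Section Domain.
Variables (R : idomainType) (M : lmodType R).
Variables (hR : noetherian R) (hMtf : torsion_free M).

Lemma torsion_free_scalerI (r : R) (x y : M) :
  r != 0 -> r *: x = r *: y -> x = y.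
Proof.
move=> r0 e; have [|/eqP|/eqP] := @hMtf r (x - y).
- by rewrite scalerBr e subrr.
- by rewrite (negPf r0).
- by rewrite subr_eq0 => /eqP.
Qed.

Lemma torsion_free_scalerIl (r s : R) (x : M) :
  x != 0 -> r *: x = s *: x -> r = s.
Proof.
move=> x0 e; have [|/eqP|/eqP] := @hMtf (r - s) x.
- by rewrite scalerBl e subrr.
- by rewrite subr_eq0 => /eqP.
- by rewrite (negPf x0).
Qed.

Lemma scaler_neq0 (r : R) (x : M) : r != 0 -> x != 0 -> r *: x != 0.
Proof.
move=> r0 x0; apply/eqP => /hMtf[] /eqP.
  by rewrite (negPf r0).
by rewrite (negPf x0).
Qed.

Variable P : prime_idealr R.

Lemma notin_prime_neq0 s : s \notin P -> s != 0.
Proof. by apply: contraNneq => ->; rewrite idealr0. Qed.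

(** Induction on the number of generators: of the generator found so far and the new one, the one
    that divides the other is kept. It serves both for [M] and for the ideal [P]. *)
Lemma prime_loc_chain_cyclic (V : lmodType R) (S : {pred V}) :
    prime_loc_chain P V -> is_submod V (fun x => x \in S) -> fin_gen S ->
  exists2 x, x \in S &
    exists2 s, s \notin P & forall y, y \in S -> exists r, s *: y = r *: x.
Proof.
move=> ch sS [n [v Sv]].
have vS i : v i \in S.
  apply/Sv; exists (fun j => (j == i)%:R).
  rewrite (bigD1 i) //= eqxx scale1r big1 ?addr0 // => j /negPf ->.
  by rewrite scale0r.
suff [x xS [s sP sv]] : exists2 x, x \in S &
    exists2 s, s \notin P & forall i, exists r, s *: v i = r *: x.
  exists x => //; exists s => // y /Sv[c ->]; have [r rE] := choice sv.
  exists (\sum_i c i * r i); rewrite scaler_sumr scaler_suml.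
  by apply: eq_bigr => i _; rewrite scalerA mulrC -scalerA rE scalerA.
elim: n v vS {Sv} => [|n IH] v vS.
  exists 0; first by case: sS.
  by exists 1 => [|[]//]; rewrite idealr1.
have [x xS [s sP sv]] := IH (fun i => v (lift ord0 i)) (fun i => vS _).
have [t tP [r [e|e]]] := ch x (v ord0).
  exists (v ord0) => //; exists (t * s) => [|i]; first exact: notin_primeM.
  case: (unliftP ord0 i) => [j ->|->]; last by exists (t * s).
  have [c ce] := sv j; exists (c * r).
  by rewrite -!scalerA ce -e !scalerA mulrC.
exists x => //; exists (t * s) => [|i]; first exact: notin_primeM.
case: (unliftP ord0 i) => [j ->|->].
  by have [c ce] := sv j; exists (t * c); rewrite -!scalerA ce.
by exists (s * r); rewrite mulrC -scalerA e scalerA.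
Qed.

(** By torsion-freeness, a nonzero [x] embeds [R] into [M] as the line through [x]. *)
Lemma prime_loc_chain_regular :
  (exists x : M, x != 0) -> prime_loc_chain P M -> prime_loc_chain P R^o.
Proof.
move=> [x x0] ch a b; have [s sP [r [e|e]]] := ch (a *: x) (b *: x);
  exists s => //; exists r; [left|right];
  by apply: (torsion_free_scalerIl x0); rewrite -!scalerA.
Qed.

(* The witness is the contraction of [P^2 M_P] to [M]. *)
Lemma prime_loc_chain_irreducible :
    (exists x : M, x != 0) -> fin_gen (predT : {pred M}) ->
    (exists2 a, a \in P & a != 0) -> prime_loc_chain P M ->
  exists N : submodClosed M,
    [/\ proper_submod N, strongly_irreducible N & ~ prime_ideal (colon N)].
Proof.
move=> M0 fgM [a aP a0] ch.
have [x _ [s sP sx]] := prime_loc_chain_cyclic ch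
  (conj isT (fun _ _ _ _ _ => isT)) fgM.
have x0 : x != 0.
  have [z z0] := M0; have [r e] := sx z isT.
  apply: contraNneq (scaler_neq0 (notin_prime_neq0 sP) z0) => x0.
  by rewrite e x0 scaler0.
have sPi : is_submod R^o (fun r => r \in P).
  by split=> [|b u v uP vP]; rewrite ?idealr0 // rpredD // idealMr.
have [I HI] := ex_submodClosed sPi.
have [p pP [t tP tp]] : exists2 p : R, p \in P &
    exists2 t, t \notin P & forall q, q \in P -> exists r, t * q = r * p.
  have [p /HI pP [t tP tp]] := prime_loc_chain_cyclic
    (prime_loc_chain_regular M0 ch) (submodClosed_is_submod I) (hR I).
  by exists p => //; exists t => // q /HI/tp.
have p0 : p != 0.
  have [r e] := tp a aP.
  apply: contraNneq (mulf_neq0 (notin_prime_neq0 tP) a0) => p0.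
  by rewrite e p0 mulr0.
pose inN y := exists2 s, s \notin P & exists r, s *: y = (r * (p * p)) *: x.
have sN : is_submod M inN.
  split=> [|b y z [u uP [r e]] [v vP [q f]]].
    by exists 1; rewrite ?idealr1 //; exists 0; rewrite scaler0 mul0r scale0r.
  exists (u * v); first exact: notin_primeM.
  exists (b * v * r + u * q).
  rewrite scalerDr mulrDl scalerDl; congr (_ + _).
    have -> : (u * v) *: (b *: y) = (b * v) *: (u *: y).
      by rewrite !scalerA; congr (_ *: _); ring.
    by rewrite e scalerA; congr (_ *: _); ring.
  by rewrite -scalerA f scalerA; congr (_ *: _); ring.
have [N HN] := ex_submodClosed sN.
have Nsat u y : u \notin P -> u *: y \in N -> y \in N.
  move=> uP /HN[v vP [r e]]; apply/HN; exists (v * u).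
    exact: notin_primeM.
  by exists r; rewrite -e scalerA.
(* Cancelling [p] and [x] in the equation would give [u = r * p], which lies in [P]. *)
have px : p *: x \notin N.
  apply/negP => /HN[u uP [r]]; rewrite scalerA => e.
  have /(mulIf p0) uE : u * p = r * p * p.
    by apply: (torsion_free_scalerIl x0); rewrite e mulrA.
  by move: uP; rewrite uE idealMr.
exists N; split.
- by exists (p *: x).
- move=> K L KL; apply: contrapT => /not_orP[KN LN]; case: KN => k kK.
  apply: contrapT => /negP kN; case: LN => l lL.
  apply: contrapT => /negP lN.
  (* Whichever of [k] and [l] is locally a multiple of the other has a multiple by [u] in both [K]
     and [L], hence in [N], and [N] is saturated. *)
  have [u uP [r [e|e]]] := ch k l.
    move/negP: kN; apply; apply: (Nsat u) => //; apply: KL.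
    by rewrite inE /= rpredZ // e rpredZ.
  move/negP: lN; apply; apply: (Nsat u) => //; apply: KL.
  by rewrite inE /= [X in _ && X]rpredZ // e rpredZ.
- case=> _ /(_ p p) cN.
  have : p * p \in colon N.
    apply/asboolP => y; apply/HN; exists s => //; have [r e] := sx y isT.
    by exists r; rewrite scalerA mulrC -[LHS]scalerA e scalerA mulrC.
  by move/cN; rewrite orbb => /asboolP/(_ x); apply/negP.
Qed.

(** Take a counterexample [d] whose local principal ideal is maximal. It lies in [P], so it is
    locally [d1 * c], where [d1] is again a counterexample. Maximality makes [d1] a local multiple
    of [d], which puts a denominator in [P]. *)
Lemma uniformizer_factor (c : R) : c \in P ->
    (forall p, p \in P -> exists2 s, s \notin P & exists r, s * p = r * c) ->
  forall d, d != 0 ->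
  exists k s e, [/\ s \notin P, e \notin P & s * d = e * c ^+ k].
Proof.
move=> cP Pc d d0; apply: contrapT => nd.
pose bad d := d != 0 /\
  ~ exists k s e, [/\ s \notin P, e \notin P & s * d = e * c ^+ k].
have [||{nd d0}{}d [d0 nd] dmax] := noetherian_max hR
  (D := bad) (I := fun d r => exists2 s, s \notin P & exists e, s * r = e * d)
  (t0 := d).
- move=> {nd d0}d; split=> [|a r r' [s sP [e E]] [s' s'P [e' E']]].
    by exists 1; rewrite ?idealr1 //; exists 0; rewrite mulr0 mul0r.
  exists (s * s'); first exact: notin_primeM.
  exists (a * s' * e + s * e'); rewrite mulrDl -[s * e' * d]mulrA -E'.
  rewrite -[a * s' * e * d]mulrA -E /GRing.scale /=; ring.
- by split.
have [dP|dP] := boolP (d \in P); last first.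
  by apply: nd; exists 0%N, 1, d; rewrite idealr1 dP mul1r mulr1.
have [s sP [d1 E1]] := Pc d dP.
have d10 : d1 != 0.
  apply: contraNneq (mulf_neq0 (notin_prime_neq0 sP) d0) => d10.
  by rewrite E1 d10 mul0r.
have [|good] := pselect (bad d1); last first.
  apply: good; split=> // -[k [t [e [tP eP E]]]]; apply: nd.
  exists k.+1, (t * s), e; split=> //; first exact: notin_primeM.
  by rewrite -mulrA E1 mulrA E exprSr mulrA.
move=> bad1; have [||t tP [e E]] := dmax d1 bad1 _ d1.
- move=> r [t tP [e E]]; exists (s * t); first exact: notin_primeM.
  by exists (e * c); rewrite -mulrA E mulrCA E1; ring.
- by exists 1; rewrite ?idealr1 //; exists 1.
have : (s * t) * d1 = (e * c) * d1 by rewrite -mulrA E mulrCA E1; ring.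
move/(mulIf d10) => stE.
by have := notin_primeM sP tP; rewrite stE idealMr.
Qed.

End Domain.

(** * Strongly irreducible submodules, locally at an associated prime *)

Section StronglyIrreducible.
Variables (R : idomainType) (M : lmodType R).
Variables (hR : noetherian R) (hMtf : torsion_free M).
Variables (N : submodClosed M) (P : prime_idealr R) (x : M).
Hypotheses (hN : strongly_irreducible N) (xN : x \notin N).
Hypothesis Px : forall a, a \in P <-> a *: x \in N.

Lemma strongly_irreducible_capture y :
  y \notin N -> exists2 a, a \notin P & exists c, a *: x = c *: y.
Proof.
move=> yN; have [a [c [e axN]]] := strongly_irreducible_cyclic hN xN yN.
by exists a; [apply: contraNN axN => /Px | exists c].
Qed.

(** If [y] is outside [N], some [a *: x] with [a] outside [P] is a multiple of [y]; then [s * a]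
    kills [x] modulo [N], although it lies outside [P]. *)
Lemma strongly_irreducible_saturated s y :
  s \notin P -> s *: y \in N -> y \in N.
Proof.
move=> sP syN; apply: contrapT => /negP.
move=> /strongly_irreducible_capture[a aP [c e]].
have := notin_primeM sP aP; apply/negP/negPn/Px.
by rewrite -scalerA e scaler_swap rpredZ.
Qed.

(* Compare the lines through [x] and [x + n], neither of which lies in [N]. *)
Lemma strongly_irreducible_below n :
  n \in N -> exists2 b, b \notin P & exists d, b *: n = d *: x.
Proof.
move=> nN; have xnN : x + n \notin N.
  apply: contraNN xN => xnN; rewrite -[x](addrK n).
  by rewrite rpredD // -scaleN1r rpredZ.
have [a [b [e axN]]] := strongly_irreducible_cyclic hN xN xnN.
exists b; last by exists (a - b); rewrite scalerBl e scalerDr addrC addKr.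
(* If [b] were in [P], both [b *: x] and [b *: n] would lie in [N], and so would [a *: x]. *)
apply: contraNN axN => /Px bxN.
by rewrite e scalerDr rpredD // rpredZ.
Qed.

(** The annihilators of [p ^+ k *: y] modulo [N] increase with [k], hence stabilize. If
    [p ^+ k *: y] stays outside [N], then [a *: x = c *: (p ^+ k *: y)] with [a] outside [P]; as [p]
    kills [x] modulo [N], [c] kills the next power, hence this one, so [a *: x] is in [N]. *)
Lemma strongly_irreducible_nilpotent p y :
  p \in P -> exists k, p ^+ k *: y \in N.
Proof.
move=> pP; have [|k _ kmax] := noetherian_max hR (D := fun _ => True)
  (I := fun k r => r *: (p ^+ k *: y) \in N) (t0 := 0%N) _ I.
  by move=> k; apply: is_submod_transporter (submodClosed_is_submod _).
exists k; apply: contrapT => /negP /strongly_irreducible_capture[a aP [c e]].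
have pcN : c *: (p ^+ k.+1 *: y) \in N.
  rewrite exprS -[(p * _) *: y]scalerA scaler_swap -e scaler_swap.
  by rewrite rpredZ //; apply/Px.
have /Px : a *: x \in N; last by apply/negP.
rewrite e; apply: (kmax k.+1) => // r rN.
by rewrite exprS -[(p * _) *: y]scalerA scaler_swap rpredZ.
Qed.

(* An associated prime of [M / S], with [S] the set of [y] lying in [R x]
   locally at [P], is equal to [P]; this makes [P] principal locally. *)
Lemma strongly_irreducible_uniformizer :
    (exists2 p, p \in P & exists y, p *: y \notin N) ->
  exists2 c, c \in P &
    forall p, p \in P -> exists2 s, s \notin P & exists r, s * p = r * c.
Proof.
move=> [p0 p0P [y0 py0N]].
pose S y := exists2 b, b \notin P & exists d, b *: y = d *: x.
have sS : is_submod M S.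
  split=> [|a y z [b bP [d e]] [b' b'P [d' e']]].
    by exists 1; rewrite ?idealr1 //; exists 0; rewrite scaler0 scale0r.
  exists (b * b'); first exact: notin_primeM.
  exists (a * b' * d + b * d'); rewrite scalerDr scalerDl -[in RHS]scalerA.
  rewrite -[(b * d') *: x]scalerA -e -e' !scalerA.
  by congr (_ *: _ + _); ring.
have Sy0 : ~ S y0.
  move=> [b bP [d e]]; move/negP: py0N; apply.
  apply: (strongly_irreducible_saturated bP).
  by rewrite scaler_swap e scaler_swap rpredZ //; apply/Px.
have [r [Q [Sy QS]]] := ex_associated_prime hR sS Sy0.
move: (r *: y0) Sy QS => y Sy QS {r y0 py0N Sy0 p0 p0P}.
(* A power of [p] sends [y] into [N], which is contained in [S], and [Q] is prime. *)
have PQ p : p \in P -> p \in Q.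
  move=> pP; have [k kN] := strongly_irreducible_nilpotent y pP.
  have: p ^+ k \in Q by apply/QS/strongly_irreducible_below.
  elim: k {kN} => [|k IH]; first by rewrite expr0 idealr1.
  by rewrite exprS prime_idealrM => /orP[].
have yN : y \notin N by apply/negP => /strongly_irreducible_below.
have [a aP [c e]] := strongly_irreducible_capture yN.
have y0 : y != 0 by apply: contraNneq yN => ->; rewrite rpred0.
exists c => [|p /PQ/QS[b bP [d f]]].
  (* With [c] outside [P], the relation [a *: x = c *: y] would put [y] in [S]. *)
  by apply: contrapT => /negP cP; apply: Sy; exists c => //; exists a.
exists (a * b); first exact: notin_primeM.
exists d; apply: (torsion_free_scalerIl hMtf y0).
by rewrite -!scalerA -e f scaler_swap.
Qed.

Lemma strongly_irreducible_loc_chain :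
    (exists2 p, p \in P & exists y, p *: y \notin N) ->
  prime_loc_chain P M.
Proof.
move=> hP; have [c cP Pc] := strongly_irreducible_uniformizer hP.
have c0 : c != 0.
  have [p pP [y pyN]] := hP; have [s sP [r e]] := Pc p pP.
  apply: contraNneq pyN => c0.
  move/eqP: e; rewrite c0 mulr0 mulf_eq0 (negPf (notin_prime_neq0 sP)).
  by move=> /eqP ->; rewrite scale0r rpred0.
have repr (z : M) : z != 0 -> exists k i u v,
    [/\ u \notin P, v \notin P & (u * c ^+ k) *: z = (v * c ^+ i) *: x].
  move=> z0; have [k kN] := strongly_irreducible_nilpotent z cP.
  (* Once in [N], [c ^+ k *: z] is locally [d *: x], and [d] is a unit times a power of [c]. *)
  have [b bP [d e]] := strongly_irreducible_below kN.
  have d0 : d != 0.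
    have bck : b *: (c ^+ k *: z) != 0.
      apply: scaler_neq0 => //; first exact: notin_prime_neq0 bP.
      by apply: scaler_neq0 => //; apply: expf_neq0.
    by apply: contraNneq bck => d0; rewrite e d0 scale0r.
  have [i [s [v [sP vP f]]]] := uniformizer_factor hR cP Pc d0.
  exists k, i, (s * b), v; split=> //; first exact: notin_primeM.
  by rewrite -f -[RHS]scalerA -e !scalerA !mulrA.
have cancel m n u v (z w : M) : (m <= n)%N -> u \notin P ->
    (u * c ^+ m) *: z = (v * c ^+ n) *: w ->
  exists2 s, s \notin P & exists r, s *: z = r *: w.
  move=> mn uP e; exists u => //; exists (v * c ^+ (n - m)).
  apply: (torsion_free_scalerI hMtf (expf_neq0 m c0)).
  by rewrite !scalerA mulrC e mulrCA -exprD subnKC.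
move=> z w; have [->|z0] := eqVneq z 0.
  by exists 1; rewrite ?idealr1 //; exists 0; left; rewrite scaler0 scale0r.
have [->|w0] := eqVneq w 0.
  by exists 1; rewrite ?idealr1 //; exists 0; right; rewrite scaler0 scale0r.
have [k [i [u [v [uP vP e]]]]] := repr _ z0.
have [l [j [u' [v' [u'P v'P e']]]]] := repr _ w0.
(* Cross-multiplying the two relations eliminates [x]; then the smaller power of [c] cancels. *)
have E : (v' * u * c ^+ (j + k)) *: z = (v * u' * c ^+ (i + l)) *: w.
  transitivity ((v' * c ^+ j) *: ((u * c ^+ k) *: z)).
    by rewrite scalerA exprD; congr (_ *: _); ring.
  transitivity ((v * c ^+ i) *: ((u' * c ^+ l) *: w)).
    by rewrite e e' !scalerA mulrC.
  by rewrite scalerA exprD; congr (_ *: _); ring.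
have [le|/ltnW le] := leqP (j + k) (i + l).
  have [|s sP [r f]] := cancel _ _ _ _ _ _ le _ E; first exact: notin_primeM.
  by exists s => //; exists r; left.
have [|s sP [r f]] := cancel _ _ _ _ _ _ le _ (esym E).
  exact: notin_primeM.
by exists s => //; exists r; right.
Qed.

End StronglyIrreducible.

Theorem corollary1p5 (R : idomainType) (M : lmodType R)
    (hR : noetherian R)
    (hM0 : exists x : M, x != 0)
    (hMfg : fin_gen (predT : {pred M}))
    (hMtf : torsion_free M) :
  (exists N : submodClosed M,
      [/\ proper_submod N, strongly_irreducible N & ~ prime_ideal (colon N)])
  <->
  (exists (P : prime_idealr R) (N : submodClosed M),
      ~ {subset ideal_mul M P <= N} /\ arithmetical (locmod P M)).
Proof.
split=> [[N [[z zN] hN Nprime]]|[P [N [PMN /arithmetical_locmodP ch]]]].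
  have [|r [P [xN Px]]] := ex_associated_prime (x := z) hR
    (submodClosed_is_submod N); first exact/negP.
  move: (r *: z) xN Px => x /negP xN Px.
  have hP : exists2 p, p \in P & exists y, p *: y \notin N.
    apply: contrapT => nP; apply: Nprime.
    (* If [P] sends [M] into [N], it is contained in the colon ideal; testing on [x] gives the
       converse inclusion. *)
    suff -> : colon N = P.
      split; first by split; [exact: idealr0|rewrite idealr1|
        move=> a u v uP vP; rewrite rpredD // idealMr].
      by move=> u v; rewrite prime_idealrM.
    apply/funext => a; apply/asboolP/idP => [aN|aP y]; first exact/Px.
    by apply: contrapT => /negP ayN; apply: nP; exists a => //; exists y.
  exists P, N; split; last first.
    apply/arithmetical_locmodP.
    exact: (strongly_irreducible_loc_chain hR hMtf hN xN Px hP).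
  have [p pP [y /negP pyN]] := hP; move=> PMN; apply/pyN/PMN/asboolP.
  exists 1%N, (fun _ => p), (fun _ => y); split=> //.
  by rewrite big_ord1.
apply: (prime_loc_chain_irreducible hR hMtf (P := P)) => //.
(* A zero [P] would make the product of [P] and [M] zero, hence contained in [N]. *)
apply: contrapT => P0; apply: PMN => _ /asboolP[n [r [v [rP ->]]]].
apply: rpred_sum => i _; have [->|ri0] := eqVneq (r i) 0.
  by rewrite scale0r rpred0.
by case: P0; exists (r i).
Qed.
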